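(* Let $A$ be a uniform topological algebra whose spectrum $M(A)$ is equicontinuous (as a set of linear functionals on $A$). Then $A$ is a uniform normed algebra, i.e. the topology of $A$ can be defined by a single uniform norm.
   Context: All algebras are associative algebras over the complex field $\mathbb{C}$, not assumed unital or complete. A topological algebra is an algebra which is also a Hausdorff topological vector space such that the multiplication is separately continuous. A uniform seminorm on an algebra $A$ is a seminorm $p$ on $A$ satisfying $p(x^{2})=p(x)^{2}$ for all $x\in A$ (by a known theorem of Dedania such a seminorm is automatically submultiplicative); a uniform norm is a uniform seminorm which is a norm. A uniform topological algebra is a topological algebra whose topology is determined by a family of uniform seminorms. A uniform normed algebra is a normed algebra $(A,\Vert\cdot\Vert)$ (submultiplicative norm) such that $\Vert x^{2}\Vert=\Vert x\Vert^{2}$ for all $x\in A$. For a topological algebra $A$, the spectrum $M(A)$ is the set of all nonzero continuous multiplicative linear functionals $A\to\mathbb{C}$. *)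

(* Defs.v *)
From HB Require Import structures.
From mathcomp Require Import all_boot all_order all_algebra.
From mathcomp Require Import complex.
From mathcomp Require Import all_classical all_reals all_analysis.

Set Implicit Arguments.
Unset Strict Implicit.
Unset Printing Implicit Defensive.

Import Order.TTheory GRing.Theory Num.Theory.
Import numFieldNormedType.Exports.

Local Open Scope classical_set_scope.
Local Open Scope ring_scope.

(* MathComp's [algType] is unital, whence the structure below. *)
HB.mixin Record Lmodule_isNonUnitalAlgebra (K : comPzRingType) A
    & GRing.Lmodule K A := {
  amul : A -> A -> A ;
  amulA : associative amul ;
  amulDl : left_distributive amul +%R ;
  amulDr : right_distributive amul +%R ;
  scale_amull : forall (k : K) (x y : A), amul (k *: x) y = k *: amul x y ;
  scale_amulr : forall (k : K) (x y : A), amul x (k *: y) = k *: amul x y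
}.

#[short(type="nonUnitalAlgType")]
HB.structure Definition NonUnitalAlgebra (K : comPzRingType) :=
  {A of GRing.Lmodule K A & Lmodule_isNonUnitalAlgebra K A}.

HB.mixin Record isHausdorffSepContinuous (K : numFieldType) A
    & Topological A & NonUnitalAlgebra K A := {
  topalg_hausdorff : hausdorff_space A ;
  amul_continuousl : forall a : A, continuous (fun x : A => amul x a) ;
  amul_continuousr : forall a : A, continuous (fun x : A => amul a x)
}.

#[short(type="topologicalAlgType")]
HB.structure Definition TopologicalAlgebra (K : numFieldType) :=
  {A of TopologicalLmodule K A & NonUnitalAlgebra K A
      & isHausdorffSepContinuous K A}.

Section UniformTopologicalAlgebras.
Context {R : realType} (A : topologicalAlgType R[i]).
Implicit Types (p : A -> R) (P : set (A -> R)).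

Definition seminorm p : Prop :=
  [/\ forall x, 0 <= p x,
      forall x y, p (x + y) <= p x + p y
    & forall (k : R[i]) x, p (k *: x) = ComplexField.Normc.normc k * p x].

Definition norm p : Prop := seminorm p /\ forall x, p x = 0 -> x = 0.

Definition square_preserving p : Prop := forall x, p (amul x x) = p x ^+ 2.

Definition uniform_seminorm p : Prop := seminorm p /\ square_preserving p.

Definition submultiplicative p : Prop :=
  forall x y, p (amul x y) <= p x * p y.

(* The seminorms of P need not be directed: basic neighbourhoods of x are
   finite intersections of balls centred at x. *)
Definition topology_determined_by P : Prop :=
  forall x : A, nbhs x =
    filter_from
      [set Fe : set (A -> R) * R |
        [/\ finite_set Fe.1, Fe.1 `<=` P & 0 < Fe.2]]
      (fun Fe => [set y | forall p, Fe.1 p -> p (y - x) < Fe.2]).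

Definition uniform_topological_algebra : Prop :=
  exists2 P, P `<=` uniform_seminorm & topology_determined_by P.

Definition uniform_normed_algebra : Prop :=
  exists p, [/\ norm p, submultiplicative p, square_preserving p
              & topology_determined_by [set p]].

(* [R[i]^o] is the complex field with its usual topology and uniformity. *)
Definition spectrum : set (A -> R[i]^o) :=
  [set f : A -> R[i]^o |
    [/\ linear f, {morph f : x y / amul x y >-> x * y},
        continuous f & exists x, f x != 0]].

End UniformTopologicalAlgebras.

Arguments uniform_topological_algebra {R} A.
Arguments uniform_normed_algebra {R} A.
Arguments spectrum {R} A _.

(* Main.v *)
Require Import Defs.
From HB Require Import structures.
From mathcomp Require Import all_boot all_order all_algebra all_solvable
  all_field.
From mathcomp Require Import complex ring lra.
From mathcomp Require Import all_classical all_reals all_analysis.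

Set Implicit Arguments.
Unset Strict Implicit.
Unset Printing Implicit Defensive.

Import Order.TTheory GRing.Theory Num.Theory.
Import numFieldNormedType.Exports.

Local Open Scope classical_set_scope.
Local Open Scope ring_scope.

(** The theorem rests on the representation of a uniform seminorm [p] as a
    supremum of characters: if [0 < p x], some multiplicative functional [f]
    satisfies [|f| <= p] and [|f x| = p x] ([exists_norming_character]).

    Granting it, let [q x] be the supremum of [|f x|] over the spectrum.
    Equicontinuity at 0 gives finitely many defining seminorms controlling all
    characters at once, so [q] is finite and continuous.  A character dominated
    by a defining seminorm is continuous, so [p <= q] for each defining [p].
    Hence [q] alone determines the topology, it is a norm because [A] is
    Hausdorff, and it is submultiplicative and square preserving because the
    modulus of a complex number is ([character_sup_topology] and its
    neighbours).

    The representation is proved by algebra in the unitization of [A], in which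
    [A] is an ideal, and with the following ideas.

    - A square preserving seminorm is submultiplicative.  Squaring controls
      Jordan products by polarization, and Jordan identities then control
      [x y] up to a constant ([mul_bound]).  Since [p (x ^ 2^k) = p x ^ 2^k],
      constants disappear when 2^k-th roots are taken; this yields
      [p (x y) = p (y x)], and the constant can be removed from [mul_bound] as
      soon as commutators are known to be null.

    - Commutators are null ([uniform_commutative]).  This is the argument of
      Hirschfeld and Zelazko, in which Liouville's theorem is applied to
      [exp (k a) b exp (- k a)]; here it is applied to the polynomial
      [(1 + k a)^n b (1 - k a)^n] on the circle of radius [1 / sqrt n].  There
      it is bounded independently of [n], while its coefficient of degree one
      is [n (a b - b a)].

    - A minimal uniform seminorm is multiplicative (Berkovich).  For [q a > 0],
      the limit of [q (b a^n) / q a ^ n] is a uniform seminorm below [q] for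
      which multiplication by [a] is homogeneous; minimality makes it equal to
      [q].  Localizing first at [x] keeps the value at [x] equal to [p x]
      ([exists_multiplicative_seminorm]).

    - A complex algebra with a multiplicative seminorm is the complex field
      modulo the null space, by Ostrowski's form of the Gelfand-Mazur theorem
      ([exists_scalar_at_null_distance]): the distance to the scalars attains its
      minimum, and the factorization of [X^n - l^n] shows that a positive
      minimum would propagate along a half line.  The scalar attached to each
      element defines the character. *)

Local Notation normc := ComplexField.Normc.normc.

(** * The unitization of an algebra *)

Section Unitization.
Context {K : comNzRingType} {A : nonUnitalAlgType K}.

(** The pair [(k, x)] stands for [k 1 + x]. *)
Definition unitization := (K * A)%type.
HB.instance Definition _ := GRing.Zmodule.on unitization.
Implicit Types (k : K) (b c : unitization).

Definition unitization_scale k b : unitization := (k * b.1, k *: b.2).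
Definition unitization_one : unitization := (1, 0).
Definition unitization_mul b c : unitization :=
  (b.1 * c.1, b.1 *: c.2 + c.1 *: b.2 + amul b.2 c.2).

Lemma amul0l (x : A) : amul 0 x = 0.
Proof. by rewrite -[X in amul X _](scale0r 0) scale_amull scale0r. Qed.

Lemma amul0r (x : A) : amul x 0 = 0.
Proof. by rewrite -[X in amul _ X](scale0r 0) scale_amulr scale0r. Qed.

Fact unitization_scaleA k l b :
  unitization_scale k (unitization_scale l b) = unitization_scale (k * l) b.
Proof. by rewrite /unitization_scale /= mulrA scalerA. Qed.

Fact unitization_scale1 : left_id 1 unitization_scale.
Proof. by move=> [a x]; rewrite /unitization_scale mul1r scale1r. Qed.

Fact unitization_scaleDr : right_distributive unitization_scale +%R.
Proof.
by move=> k [a x] [b y]; rewrite /unitization_scale /= mulrDr scalerDr.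
Qed.

Fact unitization_scaleDl b :
  {morph (fun k => unitization_scale k b) : k l / k + l}.
Proof. by move=> k l; rewrite /unitization_scale /= mulrDl scalerDl. Qed.

HB.instance Definition _ := GRing.Zmodule_isLmodule.Build K unitization
  unitization_scaleA unitization_scale1 unitization_scaleDr unitization_scaleDl.

Fact unitization_mulA : associative unitization_mul.
Proof.
move=> [a x] [b y] [c z]; rewrite /unitization_mul /= mulrA; congr pair.
rewrite !scalerDr !amulDl !amulDr !scalerA !scale_amull !scale_amulr amulA.
rewrite (mulrC c a) (mulrC c b) -!addrA; do 2 congr (_ + _).
rewrite addrCA; congr (_ + _).
by rewrite [RHS]addrCA; congr (_ + _); rewrite addrCA.
Qed.

Fact unitization_mul1b : left_id unitization_one unitization_mul.
Proof.
move=> [a x]; rewrite /unitization_mul /= mul1r scale1r scaler0 amul0l.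
by rewrite !addr0.
Qed.

Fact unitization_mulb1 : right_id unitization_one unitization_mul.
Proof.
move=> [a x]; rewrite /unitization_mul /= mulr1 scale1r scaler0 amul0r.
by rewrite addr0 add0r.
Qed.

Fact unitization_mulDl : left_distributive unitization_mul +%R.
Proof.
move=> [a x] [b y] [c z]; rewrite /unitization_mul /= mulrDl; congr pair => /=.
by rewrite scalerDl scalerDr amulDl (addrACA (a *: z)) [LHS]addrACA.
Qed.

Fact unitization_mulDr : right_distributive unitization_mul +%R.
Proof.
move=> [a x] [b y] [c z]; rewrite /unitization_mul /= mulrDr; congr pair => /=.
by rewrite scalerDl scalerDr amulDr (addrACA (a *: y)) [LHS]addrACA.
Qed.

Fact unitization_1neq0 : unitization_one != 0.
Proof. by rewrite xpair_eqE negb_and oner_neq0. Qed.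

HB.instance Definition _ := GRing.Zmodule_isNzRing.Build unitization
  unitization_mulA unitization_mul1b unitization_mulb1 unitization_mulDl
  unitization_mulDr unitization_1neq0.

Fact unitization_scalerAl k b c : k *: (b * c) = (k *: b) * c.
Proof.
congr pair => /=; first exact: mulrA.
by rewrite !scalerDr !scalerA scale_amull (mulrC k c.1).
Qed.

HB.instance Definition _ :=
  GRing.Lmodule_isLalgebra.Build K unitization unitization_scalerAl.

Fact unitization_scalerAr k b c : k *: (b * c) = b * (k *: c).
Proof.
congr pair => /=; first exact: mulrCA.
by rewrite !scalerDr !scalerA scale_amulr (mulrC k b.1).
Qed.

HB.instance Definition _ :=
  GRing.Lalgebra_isAlgebra.Build K unitization unitization_scalerAr.

End Unitization.
Arguments unitization {K} A.

(** * Seminorms and the modulus of a complex number *)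

Section Seminorms.
Context {R : realType} {V : lmodType R[i]}.

Definition is_seminorm (p : V -> R) : Prop :=
  [/\ forall x, 0 <= p x, forall x y, p (x + y) <= p x + p y
    & forall (k : R[i]) x, p (k *: x) = normc k * p x].

Lemma normc_real (r : R) : normc r%:C%C = `|r|.
Proof. by rewrite /normc /= expr0n addr0 sqrtr_sqr. Qed.

Lemma normc_nat n : normc (n%:R : R[i]) = n%:R.
Proof. by rewrite -(rmorph_nat (real_complex R)) normc_real normr_nat. Qed.

Lemma normc_ge0 (z : R[i]) : 0 <= normc z.
Proof. by case: z => a b; exact: sqrtr_ge0. Qed.

Lemma normcX (z : R[i]) n : normc (z ^+ n) = normc z ^+ n.
Proof.
elim: n => [|n IHn]; first exact: ComplexField.Normc.normc1.
by rewrite !exprS ComplexField.Normc.normcM IHn.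
Qed.

Context (p : V -> R) (p_sn : is_seminorm p).

Lemma seminorm_ge0 x : 0 <= p x.
Proof. by case: p_sn. Qed.

Lemma seminormD x y : p (x + y) <= p x + p y.
Proof. by case: p_sn. Qed.

Lemma seminormZ k x : p (k *: x) = normc k * p x.
Proof. by case: p_sn. Qed.

Lemma seminorm0 : p 0 = 0.
Proof. by rewrite -(scale0r 0) seminormZ ComplexField.Normc.normc0 mul0r. Qed.

Lemma seminormN x : p (- x) = p x.
Proof.
rewrite -scaleN1r seminormZ (_ : normc (-1) = 1) ?mul1r//.
by rewrite (normcN 1) ComplexField.Normc.normc1.
Qed.

Lemma seminormB x y : p (x - y) <= p x + p y.
Proof. by rewrite -(seminormN y) seminormD. Qed.

Lemma seminormMn x n : p (x *+ n) = n%:R * p x.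
Proof. by rewrite -scaler_nat seminormZ normc_nat. Qed.

Lemma seminorm_sum (I : Type) (r : seq I) (P : pred I) (F : I -> V) :
  p (\sum_(i <- r | P i) F i) <= \sum_(i <- r | P i) p (F i).
Proof.
elim/big_ind2: _ => [|x1 s1 x2 s2 h1 h2|//]; first by rewrite seminorm0.
by rewrite (le_trans (seminormD _ _))// lerD.
Qed.

(** A seminorm factors through the quotient by its null space: this is how
    computations modulo null elements are carried out below. *)
Lemma seminorm_eqr x y : p (x - y) = 0 -> p x = p y.
Proof.
move=> xy0; apply/eqP; rewrite eq_le.
have /= := seminormD (x - y) y; rewrite subrK xy0 add0r => ->.
by have := seminormB x (x - y); rewrite subKr xy0 addr0 => ->.
Qed.

End Seminorms.

(** * Square preserving seminorms have bounded multiplication *)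

Section UniformSeminorms.
Context {R : realType} {B : algType R[i]}.

Definition two_sided_ideal (I : set B) : Prop :=
  [/\ forall x y, I x -> I y -> I (x + y), forall b x, I x -> I (b * x)
    & forall b x, I x -> I (x * b)].

(** The square property is asked on an ideal only, because the seminorm that [p]
    induces on the unitization, [p] of the second component, kills the unit. *)
Definition uniform_on (I : set B) (p : B -> R) : Prop :=
  is_seminorm p /\ forall x, I x -> p (x ^+ 2) = p x ^+ 2.

Context (I : set B) (I_ideal : two_sided_ideal I).
Context (p : B -> R) (p_unif : uniform_on I p).

Let p_sn : is_seminorm p. Proof. by case: p_unif. Qed.

Lemma ideal_add x y : I x -> I y -> I (x + y).
Proof. by case: I_ideal => h _ _; exact: h. Qed.
Lemma ideal_mull b x : I x -> I (b * x).
Proof. by case: I_ideal => _ h _; exact: h. Qed.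
Lemma ideal_mulr b x : I x -> I (x * b).
Proof. by case: I_ideal => _ _; exact. Qed.
Lemma ideal_scale k x : I x -> I (k *: x).
Proof. by rewrite -mulr_algl; exact: ideal_mull. Qed.
Lemma ideal_sub x y : I x -> I y -> I (x - y).
Proof. by move=> Ix Iy; rewrite -scaleN1r; apply/ideal_add/ideal_scale. Qed.
Lemma ideal_exp x n : I x -> I (x ^+ n.+1).
Proof. by rewrite exprS; exact: ideal_mulr. Qed.

Lemma uniform_sq x : I x -> p (x ^+ 2) = p x ^+ 2.
Proof. by case: p_unif => _; exact. Qed.

(** Polarization: [x y + y x = (x + y)^2 - x^2 - y^2]. *)
Lemma jordan_product_bound x y (s t : R) : I x -> I y -> p x <= s -> p y <= t ->
  p (x * y + y * x) <= (s + t) ^+ 2 + s ^+ 2 + t ^+ 2.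
Proof.
move=> Ix Iy xs yt.
have -> : x * y + y * x = (x + y) ^+ 2 - x ^+ 2 - y ^+ 2.
  apply/eqP; rewrite eq_sym !subr_eq; apply/eqP.
  by rewrite !expr2 mulrDl !mulrDr [LHS](AC (2*2) (2*3*4*1)).
have sq z u : I z -> p z <= u -> p (z ^+ 2) <= u ^+ 2.
  move=> Iz zu; rewrite uniform_sq// lerXn2r// nnegrE ?(le_trans _ zu)
    ?(seminorm_ge0 p_sn)//.
apply: (le_trans (seminormB p_sn _ _)); rewrite lerD ?sq//.
apply: (le_trans (seminormB p_sn _ _)); rewrite lerD ?sq//;
  first exact: ideal_add.
by apply: (le_trans (seminormD p_sn _ _)); rewrite lerD.
Qed.

(** Only Jordan products are controlled by squares, so [x y] is recovered as half
    the sum of [x y + y x] and of the commutator.  The square of the commutator is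
    a Jordan expression: it equals [2 (x o (y x y)) - (x o y)^2] with
    [u o v = u v + v u], and [2 y x y = y o (y o x) - y^2 o x]. *)
Lemma mul_bound_unit_ball x y : I x -> I y -> p x <= 1 -> p y <= 1 ->
  p (x * y) <= 53.
Proof.
move=> Ix Iy x1 y1.
pose J (u v : B) := u * v + v * u.
have IJ u v : I u -> I v -> I (J u v).
  by move=> Iu Iv; apply: ideal_add; exact: ideal_mull.
have boundJ u v s t r : I u -> I v -> p u <= s -> p v <= t ->
    (s + t) ^+ 2 + s ^+ 2 + t ^+ 2 <= r -> p (J u v) <= r.
  by move=> Iu Iv us vt; apply: le_trans; exact: jordan_product_bound.
have x2 : p (x ^+ 2) <= 1 by rewrite uniform_sq// expr_le1 ?(seminorm_ge0 p_sn).
have y2 : p (y ^+ 2) <= 1 by rewrite uniform_sq// expr_le1 ?(seminorm_ge0 p_sn).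
have Jxy6 : p (J x y) <= 6 by apply: (boundJ _ _ 1 1) => //; lra.
have Jyx6 : p (J y x) <= 6 by apply: (boundJ _ _ 1 1) => //; lra.
(* 86 = 7^2 + 1 + 6^2, 46 = (86 + 6) / 2, 4326 = 47^2 + 1 + 46^2, and 100 exceeds
   the square root of 2 * 4326 + 6^2. *)
have yxy46 : p (y * x * y) <= 46.
  have e : (y * x * y) *+ 2 = J y (J y x) - J (y ^+ 2) x.
    apply/eqP; rewrite eq_sym subr_eq /J expr2 !mulrDr !mulrDl !mulrA mulr2n.
    by rewrite [eqbLHS](AC (2*2) (2*3*(1*4))).
  have : p ((y * x * y) *+ 2) <= 86 + 6.
    rewrite e (le_trans (seminormB p_sn _ _))// lerD//.
      by apply: (boundJ _ _ 1 6) => //; [exact: IJ | lra].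
    by apply: (boundJ _ _ 1 1) => //; [exact: ideal_exp | lra].
  by rewrite (seminormMn p_sn); lra.
have Jxyxy : p (J x (y * x * y)) <= 4326.
  by apply: (boundJ _ _ 1 46) => //; [exact/ideal_mull | lra].
have comm100 : p (x * y - y * x) <= 100.
  have Icomm : I (x * y - y * x) by apply: ideal_sub; exact: ideal_mull.
  have e : (x * y - y * x) ^+ 2 = (J x (y * x * y)) *+ 2 - (J x y) ^+ 2.
    apply/eqP; rewrite eq_sym subr_eq /J !expr2 mulr2n.
    rewrite !(mulrBl, mulrBr) !mulrDl !mulrDr !mulrA.
    rewrite opprB [eqbRHS](AC (2*2*(2*2)) (1*3*(5*8)*(2*6)*(4*7))).
    by rewrite /= !addNr !addr0.
  have : p ((x * y - y * x) ^+ 2) <= 8652 + 36.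
    rewrite e (le_trans (seminormB p_sn _ _))//; apply: lerD.
      by rewrite (seminormMn p_sn); lra.
    rewrite uniform_sq; last exact: IJ.
    rewrite (_ : 36 = 6 ^+ 2); last by ring.
    by rewrite lerXn2r ?nnegrE// (seminorm_ge0 p_sn).
  rewrite uniform_sq// => h.
  rewrite -(@ler_pXn2r _ 2) ?nnegrE ?(seminorm_ge0 p_sn)//.
  by apply: (le_trans h); lra.
have : p ((x * y) *+ 2) <= 6 + 100.
  have -> : (x * y) *+ 2 = J x y + (x * y - y * x).
    by rewrite /J mulr2n addrACA subrr addr0.
  by rewrite (le_trans (seminormD p_sn _ _))// lerD.
by rewrite (seminormMn p_sn); lra.
Qed.

(** The bound on the unit ball is transferred by homogeneity; both arguments are
    scaled by slightly more than their seminorm since that may vanish. *)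
Lemma mul_bound x y : I x -> I y -> p (x * y) <= 53 * p x * p y.
Proof.
move=> Ix Iy; have [px py] := (seminorm_ge0 p_sn x, seminorm_ge0 p_sn y).
have scaled s t : p x < s -> p y < t -> p (x * y) <= 53 * s * t.
  move=> xs yt; have s0 := le_lt_trans px xs; have t0 := le_lt_trans py yt.
  have nrm (u : R) z : 0 < u -> p z < u -> p (u^-1%:C%C *: z) <= 1.
    move=> u0 zu; rewrite (seminormZ p_sn) normc_real ger0_norm ?invr_ge0
      ?(ltW u0)//.
    by rewrite ler_pdivrMl// mulr1 ltW.
  have := mul_bound_unit_ball (ideal_scale (s^-1)%:C%C Ix) (ideal_scale
    (t^-1)%:C%C Iy) (nrm _ _ s0 xs) (nrm _ _ t0 yt).
  rewrite -scalerAl -scalerAr !(seminormZ p_sn) !normc_real !ger0_norm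
    ?invr_ge0 ?(ltW s0) ?(ltW t0)//.
  by rewrite mulrA -invfM ler_pdivrMl ?mulr_gt0// mulrC mulrA.
apply/ler_addgt0Pr => e e0.
pose d := Num.min 1 (e / (53 * (p x + p y + 1))).
have D0 : 0 < 53 * (p x + p y + 1) by lra.
have d0 : 0 < d by rewrite lt_min ltr01 divr_gt0.
have d1 : d <= 1 by rewrite ge_min lexx.
have de : d * (53 * (p x + p y + 1)) <= e by rewrite -ler_pdivlMr// ge_min
  lexx orbT.
apply: (le_trans (scaled (p x + d) (p y + d) _ _)); rewrite ?ltrDl//; nra.
Qed.

End UniformSeminorms.

(** * Cauchy's estimate for polynomials over an algebra *)

Section CauchyEstimate.
Context {R : realType} {B : algType R[i]}.

(** The n roots of [X^n - 1] are distinct, and a finite group of units of a field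
    is cyclic. *)
Lemma prim_root_complex n : (0 < n)%N -> exists w : R[i], n.-primitive_root w.
Proof.
move=> n_gt0; have [r] := closed_field_poly_normal ('X^n - 1 : {poly R[i]}).
rewrite lead_coefXnsubC// scale1r => Xn1E.
have size_r : size r = n.
  by have := size_XnsubC (1 : R[i]) n_gt0; rewrite Xn1E size_prod_XsubC => -[].
have : has n.-primitive_root r.
  apply: has_prim_root; rewrite ?size_r//.
    by apply/allP => w wr; rewrite /root_of_unity Xn1E root_prod_XsubC.
  rewrite -separable_prod_XsubC -Xn1E separable_Xn_sub_1// pnatr_eq0.
  by rewrite -lt0n.
by case/hasP => w _ ?; exists w.
Qed.

Lemma normc_prim_root n (w : R[i]) : n.-primitive_root w -> normc w = 1.
Proof.
move=> w_prim; apply/eqP.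
rewrite -(@pexpr_eq1 _ _ n) ?normc_ge0 ?(prim_order_gt0 w_prim)//.
by rewrite -normcX (prim_expr_order w_prim) ComplexField.Normc.normc1.
Qed.

Lemma sum_prim_root n (w : R[i]) (i j : 'I_n) : n.-primitive_root w ->
  \sum_(k < n) (w ^+ i / w ^+ j) ^+ k = (n * (i == j))%:R.
Proof.
move=> w_prim; have n_gt0 := prim_order_gt0 w_prim.
have w0 : w != 0.
  apply: contraTneq (w_prim) => ->; apply/negP => /prim_expr_order/eqP.
  by rewrite expr0n (gtn_eqF n_gt0) eq_sym oner_eq0.
have wXj0 : w ^+ j != 0 by rewrite expf_neq0.
have [->|i'j] := eqVneq i j.
  rewrite divff// muln1 (eq_bigr (fun=> 1)) => [|k _]; last exact: expr1n.
  by rewrite sumr_const card_ord.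
rewrite muln0; apply/eqP.
have : w ^+ i / w ^+ j - 1 != 0.
  rewrite subr_eq0 -(inj_eq (mulIf wXj0)) divfK// mul1r.
  by rewrite (eq_prim_root_expr w_prim) !modn_small.
apply: contraNT => sum0; rewrite -(inj_eq (mulIf sum0)) mul0r -subrX1.
have wn e : (w ^+ e) ^+ n = 1 by rewrite exprAC (prim_expr_order w_prim) expr1n.
by rewrite expr_div_n !wn divr1 subrr.
Qed.

Lemma comm_poly_scalar (q : {poly B}) (k : R[i]) : comm_poly q k%:A.
Proof. by rewrite /comm_poly mulr_algl mulr_algr. Qed.

(** Averaging [w^(- j k) q.[r w^k]] over the powers of a primitive n-th root of
    unity [w], with n larger than the size of [q], isolates the coefficient of
    index [j] exactly; no limit or integral is involved. *)
Lemma cauchy_estimate (p : B -> R) (q : {poly B}) (r M : R) j :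
  is_seminorm p -> 0 < r ->
  (forall k : R[i], normc k = r -> p q.[k%:A] <= M) -> r ^+ j * p q`_j <= M.
Proof.
move=> p_sn r_gt0 q_le.
set n := (size q + j).+1.
have [w w_prim] := @prim_root_complex n (ltn0Sn _).
have jn : (j < n)%N by rewrite ltnS leq_addl.
pose jo := Ordinal jn.
have nw i : normc (w ^+ i) = 1 by rewrite normcX (normc_prim_root w_prim)
  expr1n.
pose F (k : 'I_n) := (w ^+ j)^-1 ^+ k *: q.[(r%:C%C * w ^+ k)%:A].
have FE : \sum_k F k = (n%:R * r%:C%C ^+ j) *: q`_j.
  have -> : \sum_k F k = \sum_(k < n) \sum_(i < n)
      ((w ^+ i / w ^+ j) ^+ k * r%:C%C ^+ i) *: q`_i.
    apply: eq_bigr => k _; rewrite /F (@horner_coef_wide _ n); last first.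
      by rewrite /n -addnS leq_addr.
    rewrite scaler_sumr; apply: eq_bigr => i _.
    rewrite exprZn expr1n mulr_algr scalerA; congr (_ *: _).
    rewrite exprMn -[(w ^+ k) ^+ i]exprM [(k * i)%N]mulnC exprM.
    by rewrite expr_div_n exprVn; ring.
  rewrite exchange_big /= (bigD1 jo)//= [X in _ + X]big1 ?addr0 => [|i i'j].
    rewrite -scaler_suml -mulr_suml (sum_prim_root jo jo w_prim) eqxx muln1.
    by [].
  rewrite -scaler_suml -mulr_suml (sum_prim_root i jo w_prim) (negPf i'j).
  by rewrite muln0 mul0r scale0r.
have n_gt0 : 0 < n%:R :> R by rewrite ltr0n.
have : p (\sum_k F k) <= \sum_(k < n) M.
  apply: (le_trans (seminorm_sum p_sn _ _ _)); apply: ler_sum => k _.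
  rewrite /F (seminormZ p_sn) normcX ComplexField.Normc.normcV nw invr1 expr1n
    mul1r.
  by apply: q_le; rewrite ComplexField.Normc.normcM normc_real nw mulr1
    gtr0_norm.
rewrite FE (seminormZ p_sn) ComplexField.Normc.normcM normc_nat normcX
  normc_real.
by rewrite gtr0_norm// sumr_const card_ord -[M *+ n]mulr_natl -mulrA ler_pM2l.
Qed.

End CauchyEstimate.

(** * Commutators are null, and uniform seminorms are submultiplicative *)

Section Submultiplicative.
Context {R : realType}.

Lemma bernoulli (x : R) n : 0 <= x -> 1 + n%:R * x <= (1 + x) ^+ n.
Proof.
move=> x0; elim: n => [|n IHn]; first by rewrite mul0r addr0 expr0.
rewrite exprS -natr1; apply: le_trans (_ : (1 + x) * (1 + n%:R * x) <= _).
  have : 0 <= n%:R * x * x by rewrite !mulr_ge0.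
  lra.
by rewrite ler_wpM2l// addr_ge0.
Qed.

(** Removal of constants: a factor [C] is negligible against the 2^k-th power of
    a ratio larger than 1. *)
Lemma le_of_subexponential (C s t : R) : 0 <= s ->
  (forall k, t ^+ (2 ^ k) <= C * s ^+ (2 ^ k)) -> t <= s.
Proof.
move=> s0 tsC; rewrite leNgt; apply/negP => st.
have t0 : 0 < t by exact: le_lt_trans st.
have [s_eq0|s_neq0] := eqVneq s 0.
  by have := tsC 0%N; rewrite s_eq0 expn0 !expr1 mulr0 leNgt t0.
have s_gt0 : 0 < s by rewrite lt0r s_neq0.
pose x := t / s - 1.
have x0 : 0 < x by rewrite subr_gt0 ltr_pdivlMr// mul1r.
pose k := Num.bound `|C / x|.
have := tsC k; rewrite -ler_pdivrMr ?exprn_gt0// -expr_div_n.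
have -> : t / s = 1 + x by rewrite addrC subrK.
apply/negP; rewrite -ltNge.
apply: lt_le_trans (bernoulli _ (ltW x0)).
have Ck : C < k%:R * x.
  by rewrite -ltr_pdivrMr// (le_lt_trans (ler_norm _)) ?archi_boundP.
have : k%:R * x <= (2 ^ k)%:R * x.
  by rewrite ler_wpM2r ?(ltW x0)// ler_nat ltnW// ltn_expl.
lra.
Qed.

Context {B : algType R[i]} (I : set B) (I_ideal : two_sided_ideal I).
Context (p : B -> R) (p_unif : uniform_on I p).
Let p_sn : is_seminorm p. Proof. by case: p_unif. Qed.
Let p_ge0 := seminorm_ge0 p_sn.

Lemma uniform_exp2 x k : I x -> p (x ^+ (2 ^ k)) = p x ^+ (2 ^ k).
Proof.
move=> Ix; elim: k => [//|k IHk]; rewrite expnSr !exprM -IHk.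
rewrite (uniform_sq p_unif)//.
by rewrite -(prednK (expn_gt0 2 k)); exact: (ideal_exp I_ideal).
Qed.

(** The bound with a constant depending on [n] only, applied to the powers
    [x ^ 2^k], loses its constant in the limit. *)
Lemma uniform_exp_le x n : I x -> p (x ^+ n.+1) <= p x ^+ n.+1.
Proof.
move=> Ix.
have crude y : I y -> p (y ^+ n.+1) <= 53 ^+ n * p y ^+ n.+1.
  move=> Iy; elim: n => [|n IHn]; first by rewrite mul1r.
  rewrite exprS (le_trans (mul_bound I_ideal p_unif Iy (ideal_exp I_ideal _
    Iy)))//.
  by rewrite (exprS 53) (exprS (p y)) mulrACA ler_wpM2l// mulr_ge0.
apply: (@le_of_subexponential (53 ^+ n)) => [|k]; first exact: exprn_ge0.
rewrite -uniform_exp2; last exact: ideal_exp.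
rewrite exprAC (le_trans (crude _ _))// 1?uniform_exp2//.
  by rewrite -(prednK (expn_gt0 2 k)); exact: (ideal_exp I_ideal).
by rewrite exprAC.
Qed.

Lemma exp_mul_rotate (u v : B) n : (v * u) ^+ n.+1 = v * (u * v) ^+ n * u.
Proof.
elim: n => [|n IHn]; first by rewrite mulr1.
by rewrite exprS IHn exprS !mulrA.
Qed.

(** The spectral radius of [v u] is that of [u v], and [p] is its own spectral
    radius.  The factor [v] need not lie in the ideal: it is absorbed in
    [v s = v u v], which explains the shift by 3 in the exponents. *)
Lemma uniform_mulC_le u v : I u -> p (v * u) <= p (u * v).
Proof.
move=> Iu; set s := u * v; set t := v * u.
have Is : I s by exact: (ideal_mulr I_ideal v Iu).
have It : I t by exact: (ideal_mull I_ideal v Iu).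
have Ivs : I (v * s) by exact: (ideal_mull I_ideal).
pose C := 53 * (53 * p (v * s)) * p u.
have bound n : p (t ^+ n.+3) <= C * p s ^+ n.+1.
  rewrite exp_mul_rotate -/s (exprS s) (mulrA v).
  apply: (le_trans (mul_bound I_ideal p_unif _ Iu));
    first exact: (ideal_mulr I_ideal).
  rewrite /C [in leRHS]mulrAC ler_wpM2r// -[leRHS]mulrA ler_wpM2l//.
  apply: (le_trans (mul_bound I_ideal p_unif Ivs (ideal_exp I_ideal _ Is))).
  by rewrite ler_wpM2l ?mulr_ge0// uniform_exp_le.
have bound2 k : (p t ^+ 4) ^+ (2 ^ k) * p s ^+ 2 <= C * (p s ^+ 4) ^+ (2 ^ k).
  rewrite -(exprM (p t)) -(exprM (p s)) (_ : (4 * 2 ^ k = 2 ^ k.+2)%N);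
    last first.
    by rewrite !expnS mulnA.
  rewrite -uniform_exp2//.
  have [n ->] : exists n, (2 ^ k.+2 = n.+3)%N.
    exists (2 ^ k.+2 - 3)%N; rewrite -addn3 subnK// (@leq_trans (2 ^ 2))//.
    by rewrite leq_exp2l.
  rewrite -[in leRHS](addn2 n.+1) exprD mulrA.
  by rewrite ler_wpM2r ?exprn_ge0// bound.
rewrite -(@ler_pXn2r _ 4) ?nnegrE//.
have [ps0|ps_neq0] := eqVneq (p s) 0.
  rewrite ps0 expr0n -(uniform_exp2 2 It).
  by apply: (le_trans (bound 1%N)); rewrite ps0 expr0n mulr0.
apply: (@le_of_subexponential (C / p s ^+ 2)) => [|k]; first exact: exprn_ge0.
by rewrite [leRHS]mulrAC ler_pdivlMr// exprn_gt0// lt0r ps_neq0 p_ge0.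
Qed.

Lemma coef01_exp (q : {poly B}) (c : B) n : q`_0 = 1 -> q`_1 = c ->
  (q ^+ n)`_0 = 1 /\ (q ^+ n)`_1 = c *+ n.
Proof.
move=> q0 q1; elim: n => [|n [IH0 IH1]]; first by rewrite !coef1.
rewrite exprS !coefM !big_ord_recl !big_ord0 /= q0 q1 IH0 IH1 !addr0 !mul1r
  mulr1.
by rewrite -mulrSr.
Qed.

(** Although [1 - k a] is not the inverse of [1 + k a], moving the left factor to
    the right leaves [b (1 - k^2 a^2)^n], where only the square of [k] occurs. *)
Lemma conjugation_bound (a b : B) (k : R[i]) n : I a -> I b ->
  p ((1 + k *: a) ^+ n * b * (1 - k *: a) ^+ n)
    <= p b * (1 + normc k ^+ 2 * (53 * p a ^+ 2)) ^+ n.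
Proof.
move=> Ia Ib; rewrite -mulrA.
apply: le_trans (uniform_mulC_le _ _) _; first exact: (ideal_mulr I_ideal).
have comm_ka : GRing.comm (1 - k *: a) (1 + k *: a).
  by apply: commrD; [exact: commr1 | apply/commr_sym/commrB; [exact: commr1|]].
rewrite -mulrA -exprMn_comm// mulrBl mul1r mulrDr mulr1 opprD addrA addrK.
elim: n => [|n IHn]; first by rewrite !mulr1.
rewrite exprSr mulrA mulrBr mulr1; set z := b * _.
have Iz : I z by exact: (ideal_mulr I_ideal).
apply: (le_trans (seminormB p_sn _ _)).
rewrite -scalerAr -scalerAl scalerA -scalerAr (seminormZ p_sn).
rewrite ComplexField.Normc.normcM -expr2.
apply: (@le_trans _ _ (p z * (1 + normc k ^+ 2 * (53 * p a ^+ 2)))); last first.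
  by rewrite [(1 + _) ^+ n.+1]exprSr [leRHS]mulrA ler_wpM2r// addr_ge0//
    ?mulr_ge0// ?exprn_ge0// normc_ge0.
rewrite mulrDr mulr1 lerD2l mulrCA ler_wpM2l ?exprn_ge0 ?normc_ge0//.
rewrite mulrCA mulrA -expr2 -(uniform_sq p_unif)// expr2.
by apply: (mul_bound I_ideal p_unif Iz); exact: (ideal_mull I_ideal).
Qed.

(** On the circle of radius [1 / m], with [n = m^2], the polynomial
    [(1 + k a)^n b (1 - k a)^n] is bounded by [p b (1 + c / n)^n], hence by
    [p b exp c], whereas Cauchy's estimate bounds it below by
    [n p (a b - b a) / m = m p (a b - b a)]. *)
Lemma uniform_commutative (a b : B) : I a -> I b -> p (a * b - b * a) = 0.
Proof.
move=> Ia Ib; pose M := p b * expR (53 * p a ^+ 2).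
have bounded m : m%:R * p (a * b - b * a) <= M.
  case: m => [|m]; first by rewrite mul0r mulr_ge0// expR_ge0.
  pose n := (m.+1 ^ 2)%N; pose r : R := m.+1%:R^-1.
  have r_gt0 : 0 < r by rewrite invr_gt0.
  pose q : {poly B} := (1 + a *: 'X) ^+ n * b%:P * (1 - a *: 'X) ^+ n.
  have q1 : q`_1 = (a * b - b * a) *+ n.
    have [u0 u1] : ((1 + a *: 'X) ^+ n)`_0 = 1
        /\ ((1 + a *: 'X) ^+ n)`_1 = a *+ n.
      by apply: coef01_exp; rewrite coefD coef1 coefZ coefX /= ?mulr0 ?addr0
        ?mulr1 ?add0r.
    have [v0 v1] : ((1 - a *: 'X) ^+ n)`_0 = 1
        /\ ((1 - a *: 'X) ^+ n)`_1 = (- a) *+ n.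
      by apply: coef01_exp; rewrite coefB coef1 coefZ coefX /= ?mulr0 ?subr0
        ?mulr1 ?sub0r.
    rewrite /q coefM !big_ord_recl big_ord0 /= !coefMC u0 u1 v0 v1 addr0 mul1r
      mulr1.
    by rewrite addrC mulrnAl mulrnAr mulrN -mulrnDl.
  have := @cauchy_estimate _ _ p q r M 1 p_sn r_gt0.
  rewrite q1 (seminormMn p_sn) expr1 mulrA /r /n natrX expr2 mulrA mulVf
    ?pnatr_eq0// mul1r.
  apply=> k kr.
  have eval (c : B) : (1 + c *: 'X).[k%:A] = 1 + k *: c.
    by rewrite hornerD hornerZ hornerX hornerC mulr_algr.
  rewrite /q !hornerM_comm ?horner_exp_comm; try exact: comm_poly_scalar.
  rewrite -scaleNr !eval hornerC scalerN.
  apply: (le_trans (conjugation_bound _ _ Ia Ib)).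
  rewrite ler_wpM2l// kr.
  set c := 53 * p a ^+ 2.
  have c0 : 0 <= c by rewrite mulr_ge0// exprn_ge0.
  apply: le_trans (_ : expR (c / n%:R) ^+ n <= _).
    apply: lerXn2r; rewrite ?nnegrE ?expR_ge0 ?addr_ge0 ?mulr_ge0 ?exprn_ge0
      ?(ltW r_gt0)//.
    by rewrite (le_trans _ (expR_ge1Dx _))// lerD2l /r exprVn mulrC /n natrX.
  by rewrite -expRM_natr -mulrA mulVf ?mulr1// pnatr_eq0 /n.
apply/eqP; rewrite eq_le p_ge0 andbT; rewrite leNgt; apply/negP => d_gt0.
have := bounded (Num.bound `|M / p (a * b - b * a)|); apply/negP.
by rewrite -ltNge -ltr_pdivrMr// (le_lt_trans (ler_norm _)) ?archi_boundP.
Qed.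

(** Null elements of the ideal [I] absorb multiplication by the whole algebra:
    [(b z)^2] is the product of [b z b], in [I], by the null element [z]. *)
Lemma uniform_mul_null_left (b z : B) : I z -> p z = 0 -> p (b * z) = 0.
Proof.
move=> Iz z0; apply/eqP; rewrite -sqrf_eq0 -(uniform_sq p_unif);
  last exact: (ideal_mull I_ideal).
rewrite expr2 mulrA eq_le p_ge0 andbT.
apply: (le_trans (mul_bound I_ideal p_unif _ Iz)); last by rewrite z0 mulr0.
exact/(ideal_mulr I_ideal)/(ideal_mull I_ideal).
Qed.

Lemma uniform_mul_null_right (b z : B) : I z -> p z = 0 -> p (z * b) = 0.
Proof.
move=> Iz z0; apply/eqP; rewrite -sqrf_eq0 -(uniform_sq p_unif);
  last exact: (ideal_mulr I_ideal).
rewrite expr2 -mulrA eq_le p_ge0 andbT.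
apply: (le_trans (mul_bound I_ideal p_unif Iz _));
  last by rewrite z0 mulr0 mul0r.
exact/(ideal_mull I_ideal)/(ideal_mulr I_ideal).
Qed.

Lemma uniform_mulAC (b c x y : B) : I x -> I y ->
  p (b * (x * y) * c) = p (b * (y * x) * c).
Proof.
move=> Ix Iy; apply: (seminorm_eqr p_sn); rewrite -mulrBl -mulrBr.
have Icomm : I (x * y - y * x).
  by apply: (ideal_sub I_ideal); exact: (ideal_mull I_ideal).
apply: uniform_mul_null_right; first exact: (ideal_mull I_ideal).
by apply: uniform_mul_null_left => //; exact: uniform_commutative.
Qed.

(** Modulo null elements [(x y)^(2^k) = x^(2^k) y^(2^k)], so the constant of
    [mul_bound] disappears. *)
Lemma uniform_submultiplicative x y : I x -> I y -> p (x * y) <= p x * p y.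
Proof.
move=> Ix Iy.
have Ixy : I (x * y) by exact: (ideal_mulr I_ideal).
have sqM u v : I u -> I v -> p ((u * v) ^+ 2) = p (u ^+ 2 * v ^+ 2).
  by move=> Iu Iv; have := uniform_mulAC u v Iv Iu; rewrite !expr2 !mulrA.
have expM k : p ((x * y) ^+ (2 ^ k)) = p (x ^+ (2 ^ k) * y ^+ (2 ^ k)).
  rewrite uniform_exp2//; elim: k => [//|k IHk]; rewrite expnSr exprM IHk.
  have Ipow z : I z -> I (z ^+ (2 ^ k)).
    by move=> Iz; rewrite -(prednK (expn_gt0 2 k)); exact: (ideal_exp I_ideal).
  rewrite !exprM -sqM ?(uniform_sq p_unif)//; try exact: Ipow.
  exact/(ideal_mulr I_ideal)/Ipow.
apply: (@le_of_subexponential 53) => [|k]; first exact: mulr_ge0.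
rewrite -uniform_exp2// expM exprMn -!uniform_exp2// mulrA.
by apply: (mul_bound I_ideal p_unif); rewrite -(prednK (expn_gt0 2 k));
  exact: (ideal_exp I_ideal).
Qed.

End Submultiplicative.

(** * Localization of a uniform seminorm *)

Section Localization.
Context {R : realType} {B : algType R[i]} (I : set B).
Context (I_ideal : two_sided_ideal I) (p : B -> R) (p_unif : uniform_on I p).
Context (a : B) (Ia : I a) (pa_gt0 : 0 < p a).
Let p_sn : is_seminorm p. Proof. by case: p_unif. Qed.
Let p_ge0 := seminorm_ge0 p_sn.

(** The limit of this sequence is the largest seminorm that is dominated by [p] on
    the ideal and is multiplied by [p a] when its argument is multiplied by [a].
    The exponent starts at 1 because [b * a ^+ n] has to be in the ideal. *)
Definition loc_seq b : R ^nat := fun n => p (b * a ^+ n.+1) / p a ^+ n.+1.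
Definition localize b : R := limn (loc_seq b).

Let paX_gt0 n : 0 < p a ^+ n. Proof. exact: exprn_gt0. Qed.
Let IaX n : I (a ^+ n.+1). Proof. exact: (ideal_exp I_ideal). Qed.
Let IbaX b n : I (b * a ^+ n.+1). Proof. exact: (ideal_mull I_ideal). Qed.

Lemma loc_seq_ge0 b n : 0 <= loc_seq b n.
Proof. by rewrite divr_ge0// ltW. Qed.

Lemma loc_seq_nonincreasing b : nonincreasing_seq (loc_seq b).
Proof.
apply/nonincreasing_seqP => n; rewrite /loc_seq ler_pdivrMr//.
rewrite [p a ^+ n.+2]exprSr [leRHS]mulrA divfK ?gt_eqF//.
rewrite [a ^+ n.+2]exprSr (mulrA b).
exact: (uniform_submultiplicative I_ideal p_unif).
Qed.

Lemma is_cvg_loc_seq b : cvgn (loc_seq b).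
Proof.
apply: nonincreasing_is_cvgn; first exact: loc_seq_nonincreasing.
by exists 0 => _ [n _ <-]; exact: loc_seq_ge0.
Qed.

Lemma cvg_loc_seq b : loc_seq b @ \oo --> localize b.
Proof. exact: is_cvg_loc_seq. Qed.

Lemma localize_le_seq b n : localize b <= loc_seq b n.
Proof.
apply: nonincreasing_cvgn_ge; first exact: loc_seq_nonincreasing.
exact: is_cvg_loc_seq.
Qed.

Lemma localize_le b : I b -> localize b <= p b.
Proof.
move=> Ib; apply: le_trans (localize_le_seq b 0) _.
rewrite /loc_seq !expr1 ler_pdivrMr//.
exact: (uniform_submultiplicative I_ideal p_unif).
Qed.

Lemma uniform_exp n : p (a ^+ n.+1) = p a ^+ n.+1.
Proof.
apply/eqP; rewrite eq_le (uniform_exp_le I_ideal p_unif)//=.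
have [m nm] : exists m, (2 ^ n.+1 = n.+1 + m.+1)%N.
  exists (2 ^ n.+1 - n.+2)%N; rewrite addnS -addSn subnKC//.
  exact: ltn_expl.
have := uniform_exp2 I_ideal p_unif n.+1 Ia; rewrite nm !exprD => e.
rewrite -(ler_pM2r (paX_gt0 m.+1)) -e.
apply: le_trans (uniform_submultiplicative I_ideal p_unif _ _) _ => //.
by rewrite ler_wpM2l// (uniform_exp_le I_ideal p_unif).
Qed.

Lemma localize1 : localize 1 = 1.
Proof.
apply/cvg_lim => //; rewrite (_ : loc_seq 1 = cst 1); first exact: cvg_cst.
by apply/funext => n; rewrite /loc_seq mul1r uniform_exp divff// gt_eqF.
Qed.

Lemma localize_seminorm : is_seminorm localize.
Proof.
split => [b|b c|k b].
- by apply: limr_ge; [exact: is_cvg_loc_seq|near=> n; exact: loc_seq_ge0].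
- rewrite -(cvg_lim _ (cvgD (@cvg_loc_seq b) (@cvg_loc_seq c)))//.
  apply: ler_lim.
  + exact: is_cvg_loc_seq.
  + apply: is_cvgD; exact: is_cvg_loc_seq.
  + near=> n; rewrite /loc_seq/= -mulrDl ler_pM2r ?invr_gt0// mulrDl.
    exact: (seminormD p_sn).
- apply/cvg_lim => //.
  rewrite (_ : loc_seq _ = (fun n => normc k * loc_seq b n)).
    by apply: cvgMr; exact: cvg_loc_seq.
  by apply/funext => n; rewrite /loc_seq -scalerAl (seminormZ p_sn) mulrA.
Unshelve. all: by end_near. Qed.

(** The localized seminorm is homogeneous for multiplication by [a]. *)
Lemma localize_mulr b : localize (b * a) = localize b * p a.
Proof.
apply/cvg_lim => //.
rewrite (_ : loc_seq _ = (fun n => loc_seq b n.+1 * p a)).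
  by apply: cvgMl; rewrite (cvg_shiftS (loc_seq b)); exact: cvg_loc_seq.
apply/funext => n; rewrite /loc_seq -mulrA -exprS.
by rewrite [p a ^+ n.+2]exprSr invfM -[RHS]mulrA divfK ?gt_eqF//.
Qed.

(** Homogeneity for multiplication by some [x] survives a further localization;
    this is what keeps the value at a chosen element fixed. *)
Lemma localize_eigen x (c : R) : I x -> (forall b, p (b * x) = p b * c) ->
  forall b, localize (b * x) = localize b * c.
Proof.
move=> Ix px b; apply/cvg_lim => //.
rewrite (_ : loc_seq _ = (fun n => loc_seq b n * c)).
  by apply: cvgMl; exact: cvg_loc_seq.
apply/funext => n; rewrite /loc_seq -[b * x * _]mulrA.
have := uniform_mulAC I_ideal p_unif b 1 Ix (IaX n).
by rewrite !mulr1 => ->; rewrite mulrA px mulrAC.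
Qed.

(** Modulo null elements [(b a^m)^2 = b^2 a^(2m)]: the squares of the terms of
    the sequence for [b] form a subsequence of the one for [b ^+ 2]. *)
Lemma localize_uniform : uniform_on setT localize.
Proof.
split=> [|b _]; first exact: localize_seminorm.
pose sub n := (2 * n).+1.
have sub_oo : sub @ \oo --> \oo.
  apply: (@cvg_comp _ _ _ (muln 2) (addn 1)); last exact: cvg_addnl.
  exact: cvg_mulnl.
have sq_sub : loc_seq (b ^+ 2) \o sub = (fun n => loc_seq b n * loc_seq b n).
  apply/funext => n; rewrite /= /loc_seq mulrACA -invfM -exprD -expr2.
  rewrite (_ : (sub n).+1 = n.+1 + n.+1)%N;
    last by rewrite /sub mul2n -addnn addSn addnS.
  rewrite -(uniform_sq p_unif)//; congr (_ / _).
  have := uniform_mulAC I_ideal p_unif b 1 (IaX n) (IbaX b n).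
  by rewrite !mulr1 !expr2 exprD !mulrA.
have := cvg_comp _ _ sub_oo (@cvg_loc_seq (b ^+ 2)).
have := cvgM (@cvg_loc_seq b) (@cvg_loc_seq b).
rewrite -[X in X @ \oo]sq_sub => l1 l2.
rewrite [RHS]expr2 -(cvg_lim _ l2)//; apply: cvg_lim => //; exact: l1.
Qed.
End Localization.

(** * Minimal uniform seminorms are multiplicative *)

Section ChainInfimum.
Context {R : realType} {B : Type} (C : set (B -> R)).
Context (C_neq0 : C !=set0) (C_ge0 : forall q, C q -> forall b, 0 <= q b).
Context (C_chain : forall q r, C q -> C r ->
  (forall b, q b <= r b) \/ (forall b, r b <= q b)).

Definition pointwise_inf b : R := inf [set q b | q in C].

Lemma pointwise_inf_le q b : C q -> pointwise_inf b <= q b.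
Proof.
move=> Cq; apply: ge_inf; last by exists q.
by exists 0 => _ [r Cr <-]; exact: C_ge0.
Qed.

Lemma le_pointwise_inf b t :
  (forall q, C q -> t <= q b) -> t <= pointwise_inf b.
Proof.
move=> tC; apply: lb_le_inf; first by case: C_neq0 => q Cq; exists (q b), q.
by move=> _ [r Cr <-]; exact: tC.
Qed.

Lemma pointwise_inf_lt b t : pointwise_inf b < t -> exists2 q, C q & q b < t.
Proof.
move=> bt; apply: contrapT => noq.
suff : t <= pointwise_inf b by rewrite leNgt bt.
apply: le_pointwise_inf => q Cq; rewrite leNgt; apply/negP => qbt.
by apply: noq; exists q.
Qed.

Lemma pointwise_infD (add : B -> B -> B) x y :
  (forall q, C q -> q (add x y) <= q x + q y) ->
  pointwise_inf (add x y) <= pointwise_inf x + pointwise_inf y.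
Proof.
move=> CD; apply/ler_addgt0Pr => e e0; have e20 : 0 < e / 2 by rewrite divr_gt0.
have lt_inf z : pointwise_inf z < pointwise_inf z + e / 2 by rewrite ltrDl.
have [q Cq qx] := pointwise_inf_lt (lt_inf x).
have [r Cr ry] := pointwise_inf_lt (lt_inf y).
have [s Cs [sx sy]] : exists2 s, C s & s x <= q x /\ s y <= r y.
  by have [qr|rq] := C_chain Cq Cr; [exists q | exists r].
apply: le_trans (pointwise_inf_le _ Cs) _; apply: le_trans (CD _ Cs) _.
lra.
Qed.

(** Scaling by a constant and squaring are instances of [phi]; they commute with
    the infimum of a chain by continuity and monotonicity. *)
Lemma pointwise_inf_map (phi : R -> R) x y : continuous phi ->
  (forall s t, 0 <= s -> s <= t -> phi s <= phi t) ->
  (forall q, C q -> q y = phi (q x)) ->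
  pointwise_inf y = phi (pointwise_inf x).
Proof.
move=> phi_cont phi_mono Cphi; apply/eqP; rewrite eq_le.
apply/andP; split; last first.
  apply: le_pointwise_inf => q Cq; rewrite Cphi//.
  apply: phi_mono; last exact: pointwise_inf_le.
  by apply: le_pointwise_inf => r Cr; exact: C_ge0.
have cvg_phi : phi t @[t --> (pointwise_inf x)^'+] --> phi (pointwise_inf x).
  by apply: cvg_at_right_filter; exact: phi_cont.
rewrite -(cvg_lim _ cvg_phi)//; apply: limr_ge; first exact: cvgP cvg_phi.
near=> t; have [|q Cq qxt] := @pointwise_inf_lt x t.
  by near: t; exact: nbhs_right_gt.
apply: le_trans (pointwise_inf_le _ Cq) _; rewrite Cphi//.
by apply: phi_mono; [exact: C_ge0 | exact: ltW].
Unshelve. all: by end_near. Qed.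

End ChainInfimum.

Section MultiplicativeSeminorm.
Context {R : realType} {B : algType R[i]}.

Definition multiplicative_seminorm (q : B -> R) : Prop :=
  [/\ is_seminorm q, q 1 = 1 & forall x y, q (x * y) = q x * q y].

Lemma idealT : two_sided_ideal [set: B]. Proof. by split. Qed.

(** The requirement [q (b * a) = q b * p a] is stable under infima of chains and
    under localization, and it forces [q a = p a].  It holds for [localize p a], so
    Zorn's lemma provides a minimal [q], which coincides with all its
    localizations. *)
Lemma exists_multiplicative_seminorm (I : set B) (p : B -> R) (a : B) :
  two_sided_ideal I -> uniform_on I p -> I a -> 0 < p a ->
  exists q, [/\ multiplicative_seminorm q, forall x, I x -> q x <= p x
    & q a = p a].
Proof.
move=> I_ideal p_unif Ia pa0.
pose S (q : B -> R) := [/\ uniform_on setT q, q 1 = 1,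
  forall b, q (b * a) = q b * p a & forall b, I b -> q b <= p b].
have S0 : S (localize p a).
  split; [exact: (localize_uniform I_ideal)|exact: (localize1 I_ideal)| |].
  - exact: (localize_mulr I_ideal).
  - exact: (localize_le I_ideal).
have [q Sq q_min] : exists2 q, S q &
    forall r, S r -> (forall b, r b <= q b) -> r = q.
  pose T := {q | S q}.
  pose le (q r : T) := `[< forall b, sval r b <= sval q b >].
  have [||||q q_max] := @Zorn T le.
  - by move=> q; apply/asboolP.
  - move=> q r s /asboolP qr /asboolP rs; apply/asboolP => b.
    exact: le_trans (rs b) (qr b).
  - move=> [q Sq] [r Sr] /asboolP qr /asboolP rq; apply: eq_exist.
    by apply/funext => b; apply/eqP; rewrite eq_le qr rq.
  - move=> F F_chain; have [F0|F0] := pselect (F !=set0); last first.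
      by exists (exist _ _ S0) => s Fs; case: F0; exists s.
    pose C := [set sval q | q in F].
    have CS q : C q -> S q by move=> [[r Sr] _ <-].
    have C0 : C !=set0 by case: F0 => q Fq; exists (sval q), q.
    have C_ge0 q : C q -> forall b, 0 <= q b.
      by move=> /CS[[q_sn _] _ _ _]; exact: seminorm_ge0.
    have C_chain q r : C q -> C r ->
        (forall b, q b <= r b) \/ (forall b, r b <= q b).
      move=> [q' Fq <-] [r' Fr <-].
      by have [/asboolP|/asboolP] := F_chain _ _ Fq Fr; [right|left].
    have Si : S (pointwise_inf C).
      split; first split; first split.
      + by move=> b; apply: le_pointwise_inf => // q Cq; exact: C_ge0.
      + by move=> b c; apply: pointwise_infD => // q /CS[[q_sn _] _ _ _];
        exact: seminormD.
      + move=> k b; apply: (@pointwise_inf_map _ _ C C0 C_ge0 ( *%R (normc k))).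
        * exact: mulrl_continuous.
        * by move=> s t _ st; rewrite ler_wpM2l// normc_ge0.
        * by move=> q /CS[[q_sn _] _ _ _]; exact: seminormZ.
      + move=> b _; apply: (@pointwise_inf_map _ _ C C0 C_ge0
          (fun t => t ^+ 2)).
        * exact: exprn_continuous.
        * by move=> s t s0 st; rewrite lerXn2r// nnegrE (le_trans s0).
        * by move=> q /CS[[_ q_sq] _ _ _]; exact: q_sq.
      + apply/eqP; rewrite eq_le; apply/andP; split.
          by case: C0 => q Cq; have [_ <- _ _] := CS _ Cq;
            exact: pointwise_inf_le.
        by apply: le_pointwise_inf => // q /CS[_ -> _ _].
      + move=> b; apply: (@pointwise_inf_map _ _ C C0 C_ge0 (fun t => t * p a)).
        * exact: mulrr_continuous.
        * by move=> s t _ st; rewrite ler_wpM2r// ltW.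
        * by move=> q /CS[_ _ q_a _].
      + move=> b Ib; case: C0 => q Cq; have [_ _ _ q_le] := CS _ Cq.
        by apply: le_trans (q_le b Ib); exact: pointwise_inf_le.
    exists (exist _ _ Si) => q Fq; apply/asboolP => b /=.
    by apply: pointwise_inf_le => //; exists q.
  exists (sval q); first exact: svalP.
  move=> r Sr rq; suff /(congr1 sval) : exist _ r Sr = q by [].
  by apply: q_max; apply/asboolP.
have [q_unif q1 q_a q_le] := Sq; have [q_sn q_sq] := q_unif.
have q_sub := uniform_submultiplicative idealT q_unif.
exists q; split => //; last by have := q_a 1; rewrite !mul1r q1 mul1r.
split=> // x y; have [qy0|qy_neq0] := eqVneq (q y) 0.
  apply/eqP; rewrite qy0 mulr0 eq_le (seminorm_ge0 q_sn) andbT.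
  by apply: le_trans (q_sub x y _ _) _ => //; rewrite qy0 mulr0.
have qy_gt0 : 0 < q y by rewrite lt0r qy_neq0 (seminorm_ge0 q_sn).
have loc_q : localize q y = q.
  apply: q_min => [|b]; last exact: (localize_le idealT q_unif).
  split; [exact: (localize_uniform idealT)|exact: (localize1 idealT)| |].
  - exact: (localize_eigen idealT).
  - by move=> b Ib; apply: le_trans (q_le b Ib);
    exact: (localize_le idealT q_unif).
by rewrite -{1}loc_q (localize_mulr idealT q_unif)// loc_q.
Qed.
End MultiplicativeSeminorm.

(** * The Gelfand-Mazur theorem for multiplicative seminorms *)

Section GelfandMazur.
Context {R : realType} {B : algType R[i]} (q : B -> R).
Context (q_mult : multiplicative_seminorm q).
Let q_sn : is_seminorm q. Proof. by case: q_mult. Qed.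
Let q1 : q 1 = 1. Proof. by case: q_mult. Qed.
Let qM x y : q (x * y) = q x * q y. Proof. by case: q_mult. Qed.
Let q_ge0 := seminorm_ge0 q_sn.

Lemma multiplicative_scalar (k : R[i]) : q k%:A = normc k.
Proof. by rewrite (seminormZ q_sn) q1 mulr1. Qed.

Lemma multiplicative_exp b n : q (b ^+ n) = q b ^+ n.
Proof. by elim: n => [//|n IHn]; rewrite !exprS qM IHn. Qed.

Context (x : B).
Let g (k : R[i]) := q (x - k%:A).

Lemma dist_scalar_lipschitz k l : g k - g l <= normc (k - l).
Proof.
rewrite lerBlDl -multiplicative_scalar /g.
rewrite (_ : x - k%:A = (x - l%:A) - (k - l)%:A); first exact: seminormB.
by rewrite scalerBl opprB addrA subrK.
Qed.

Lemma dist_scalar_ge k : normc k - q x <= g k.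
Proof.
rewrite lerBlDr -multiplicative_scalar /g -(seminormN q_sn k%:A) addrC.
rewrite -[X in X <= _](_ : q (- x + (x - k%:A)) = _); last by rewrite addKr.
by rewrite (le_trans (seminormD q_sn _ _))// (seminormN q_sn).
Qed.

Lemma normc_ge_coord (a b : R) :
  `|a| <= normc (a +i* b)%C /\ `|b| <= normc (a +i* b)%C.
Proof.
rewrite -!sqrtr_sqr /normc; split; rewrite ler_wsqrtr// ?lerDl ?lerDr sqr_ge0//.
Qed.

Lemma normc_le_coord (a b : R) : normc (a +i* b)%C <= `|a| + `|b|.
Proof.
rewrite -(@ler_pXn2r _ 2)// ?nnegrE ?addr_ge0//; last exact: sqrtr_ge0.
rewrite sqr_sqrtr ?addr_ge0 ?sqr_ge0// sqrrD !real_normK ?num_real//.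
by rewrite -addrA lerD2l lerDr mulrn_wge0// mulr_ge0.
Qed.

(** The distance is Lipschitz in the scalar and exceeds its value at 0 outside a
    square of half side [2 q x], which is compact. *)
Lemma dist_scalar_min : exists k0, forall k, g k0 <= g k.
Proof.
pose M := 2 * q x; have M0 : 0 <= M by rewrite mulr_ge0.
pose K : set (R * R) := `[- M, M] `*` `[- M, M].
pose h (u : R * R) := g (u.1 +i* u.2)%C.
have K0 : K (0, 0) by split; rewrite /= in_itv /= oppr_le0 M0.
have h_cont : continuous h.
  move=> u; apply/cvgrPdist_lt => e e0.
  have e20 : 0 < e / 2 by rewrite divr_gt0.
  have nb_u : nbhs u (ball u (e / 2)) by exact: nbhsx_ballx.
  near=> v.
  have [v1 v2] : `|u.1 - v.1| < e / 2 /\ `|u.2 - v.2| < e / 2.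
    have : ball u (e / 2) v.
      by near: v; exact: nb_u.
    by [].
  have dist_uv : normc ((u.1 +i* u.2) - (v.1 +i* v.2))%C < e.
    apply: le_lt_trans (normc_le_coord _ _) _.
    by rewrite [e]splitr ltrD.
  rewrite ltr_norml ltrNl opprB; apply/andP; split.
    apply: le_lt_trans (dist_scalar_lipschitz _ _) _.
    by rewrite -normcN opprB.
  exact: le_lt_trans (dist_scalar_lipschitz _ _) _.
have [|||u _ u_min] := @compact_EVT_min _ R h K.
- by exists (0, 0).
- by apply: compact_setX; exact: segment_compact.
- exact: continuous_subspaceT.
exists (u.1 +i* u.2)%C => -[a b].
have [aM|Ma] := leP `|a| M; last first.
  apply: le_trans (u_min (0, 0) (mem_set K0)) _.
  rewrite /h /g /= scale0r subr0; apply: le_trans (dist_scalar_ge _).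
  by have [ha _] := normc_ge_coord a b; move: Ma; rewrite /M; lra.
have [bM|Mb] := leP `|b| M; last first.
  apply: le_trans (u_min (0, 0) (mem_set K0)) _.
  rewrite /h /g /= scale0r subr0; apply: le_trans (dist_scalar_ge _).
  by have [_ hb] := normc_ge_coord a b; move: Mb; rewrite /M; lra.
apply: (u_min (a, b)); apply/mem_set; split; rewrite /= in_itv /= -ler_norml//.
Unshelve. all: by end_near. Qed.

Lemma prod_ge_exp (I : Type) (r : seq I) (F : I -> R) (m : R) : 0 <= m ->
  (forall i, m <= F i) -> m ^+ size r <= \prod_(i <- r) F i.
Proof.
move=> m0 mF; elim: r => [|i r IHr]; first by rewrite big_nil.
by rewrite big_cons exprS ler_pM// exprn_ge0.
Qed.

(** All the factors of [z^(n+1) - k^(n+1)] are of the form [z - l], so all but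
    [z - k] can be bounded below by [m]. *)
Lemma power_minus_scalar_ge (z : B) (m : R) (k : R[i]) n : 0 <= m ->
  (forall l, m <= q (z - l%:A)) ->
  q (z - k%:A) * m ^+ n <= q (z ^+ n.+1 - (k ^+ n.+1)%:A).
Proof.
move=> m0 mz.
have [r] := closed_field_poly_normal ('X^(n.+1) - (k ^+ n.+1)%:P : {poly R[i]}).
rewrite lead_coefXnsubC// scale1r => XnkE.
have size_r : size r = n.+1.
  by have := size_XnsubC (k ^+ n.+1) (ltn0Sn n);
    rewrite XnkE size_prod_XsubC => -[].
have kr : k \in r by rewrite -root_prod_XsubC -XnkE /root !hornerE subrr.
have /(congr1 (horner_alg z)) := XnkE.
rewrite rmorphB rmorphXn rmorph_prod /= horner_algX horner_algC => ->.
under eq_bigr do rewrite rmorphB /= horner_algX horner_algC.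
rewrite (big_morph q qM q1) (big_rem k)//= ler_wpM2l//.
rewrite -[n]/(n.+1.-1) -size_r -(size_rem kr).
exact: prod_ge_exp.
Qed.

(** With [z = x - k],
    [q (z - l) m^n <= q (z^(n+1) - l^(n+1)) <= m^(n+1) + (m/2)^(n+1)],
    so [q (z - l) <= m (1 + 2^-(n+1))] for all [n]. *)
Lemma min_propagates (m : R) k l : 0 < m -> (forall j, m <= g j) -> g k = m ->
  normc l <= m / 2 -> g (k + l) = m.
Proof.
move=> m0 m_min gk lm; apply/eqP; rewrite eq_le m_min andbT.
have halfX n : g (k + l) <= m + m * 2^-1 ^+ n.+1.
  rewrite -(ler_pM2r (exprn_gt0 n m0)).
  have zE j : x - k%:A - j%:A = x - (k + j)%:A by rewrite scalerDl opprD addrA.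
  rewrite /g -zE.
  apply: le_trans (power_minus_scalar_ge l n (ltW m0) _) _ => [j|].
    by rewrite zE; exact: m_min.
  apply: le_trans (seminormB q_sn _ _) _.
  rewrite multiplicative_scalar normcX multiplicative_exp -/(g k) gk.
  rewrite mulrDl -exprS mulrAC -exprS -exprMn lerD2l.
  by rewrite lerXn2r// nnegrE ?normc_ge0// divr_ge0// ltW.
apply/ler_addgt0Pr => e e0; pose n := Num.bound (m / e).
apply: le_trans (halfX n) _; rewrite lerD2l exprVn ler_pdivrMr ?exprn_gt0//.
have mn : m / e < n%:R by rewrite archi_boundP// divr_ge0// ltW.
rewrite mulrC -ler_pdivrMr// (le_trans (ltW mn))// -natrX ler_nat.
by rewrite ltnW// (leq_trans (ltn_expl n (isT : 1 < 2)%N))// leq_exp2l.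
Qed.

(** A positive minimum would be attained along a whole half line of scalars, which
    contradicts that the distance grows like the modulus of the scalar. *)
Lemma exists_scalar_at_null_distance : exists k : R[i], q (x - k%:A) = 0.
Proof.
have [k0 k0_min] := dist_scalar_min; exists k0; apply/eqP.
apply: contraT => gk0_neq0.
have m0 : 0 < g k0 by rewrite lt0r gk0_neq0 /g q_ge0.
pose d := (g k0 / 2)%:C%C.
have gd n : g (k0 + d *+ n) = g k0.
  elim: n => [|n IHn]; first by rewrite addr0.
  rewrite mulrSr addrA; apply: min_propagates => //.
  by rewrite normc_real ger0_norm// divr_ge0// ltW.
pose n := Num.bound ((q x + normc k0 + g k0) / (g k0 / 2)).
have n_gt : q x + normc k0 + g k0 < n%:R * (g k0 / 2).
  by rewrite -ltr_pdivrMr ?divr_gt0// archi_boundP// divr_ge0 ?divr_ge0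
    ?addr_ge0 ?normc_ge0// ltW.
have := dist_scalar_ge (k0 + d *+ n); rewrite gd.
have : normc (d *+ n) <= normc (k0 + d *+ n) + normc k0.
  rewrite -{1}(addKr k0 (d *+ n)) addrC -(normcN k0); exact: le_normcD.
rewrite normcMn normc_real ger0_norm ?divr_ge0 ?(ltW m0)// -mulr_natl.
by move: n_gt; lra.
Qed.
End GelfandMazur.

(** * Characters *)

Section Characters.
Context {R : realType}.

(** The scalar at null distance from [x] is unique, hence depends on [x] linearly
    and multiplicatively. *)
Lemma multiplicative_seminorm_character (B : algType R[i]) (q : B -> R) :
  multiplicative_seminorm q ->
  exists f : B -> R[i]^o, [/\ linear f, {morph f : x y / x * y}
    & forall x, normc (f x) = q x].
Proof.
move=> q_mult; have [q_sn q1 qM] := q_mult.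
have [f qf] := choice (exists_scalar_at_null_distance q_mult).
have f_uniq x k : q (x - k%:A) = 0 -> f x = k.
  move=> qk; apply/eqP; rewrite -subr_eq0; apply/eqP.
  apply: ComplexField.Normc.eq0_normc; rewrite -(multiplicative_scalar q_mult).
  rewrite (_ : (f x - k)%:A = (x - k%:A) - (x - (f x)%:A)).
    apply/eqP; rewrite eq_le (seminorm_ge0 q_sn) andbT.
    by apply: le_trans (seminormB q_sn _ _) _; rewrite qk qf addr0.
  by rewrite scalerBl opprB [RHS]addrC subrKA.
exists f; split => [a x y|x y|x].
- apply: f_uniq; rewrite scalerDl -scalerA.
  have -> : a *: x + y - (a *: (f x)%:A + (f y)%:A)
      = a *: (x - (f x)%:A) + (y - (f y)%:A) by rewrite scalerBr opprD addrACA.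
  apply/eqP; rewrite eq_le (seminorm_ge0 q_sn) andbT.
  by apply: le_trans (seminormD q_sn _ _) _;
    rewrite (seminormZ q_sn) !qf mulr0 addr0.
- apply: f_uniq.
  have -> : x * y - (f x * f y)%:A
      = (x - (f x)%:A) * y + f x *: (y - (f y)%:A).
    by rewrite mulrBl mulr_algl scalerBr scalerA subrKA.
  apply/eqP; rewrite eq_le (seminorm_ge0 q_sn) andbT.
  by apply: le_trans (seminormD q_sn _ _) _;
    rewrite (seminormZ q_sn) qM !qf mulr0 mul0r addr0.
- rewrite -(multiplicative_scalar q_mult).
  by rewrite -(seminorm_eqr q_sn (qf x)).
Qed.

Lemma exists_norming_character (A : topologicalAlgType R[i])
    (p : A -> R) (x : A) :
  uniform_seminorm p -> 0 < p x ->
  exists f : A -> R[i]^o, [/\ linear f, {morph f : y z / amul y z >-> y * z},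
    forall y, normc (f y) <= p y & normc (f x) = p x].
Proof.
move=> [[p_ge0 pD pZ] p_sq] px_gt0.
pose I := [set b : unitization A | b.1 = 0].
pose P (b : unitization A) := p b.2.
pose j (y : A) : unitization A := (0, y).
have I_ideal : two_sided_ideal I.
  split=> [b c|b c|b c]; rewrite /I /=.
  - by move=> -> ->; rewrite addr0.
  - by move=> ->; rewrite mulr0.
  - by move=> ->; rewrite mul0r.
have jM y z : j (amul y z) = j y * j z.
  by congr pair; rewrite /= ?mul0r// !scale0r !add0r.
have P_unif : uniform_on I P.
  split=> [|[k y]]; first by split => [b|b c|k b];
    [exact: p_ge0|exact: pD|exact: pZ].
  by rewrite /I /= => ->; rewrite -[(0, y)]/(j y) expr2 -jM; exact: p_sq.
have [q [q_mult q_le qx]] :=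
  exists_multiplicative_seminorm I_ideal P_unif (erefl : I (j x)) px_gt0.
have [f [f_lin fM fq]] := multiplicative_seminorm_character q_mult.
exists (f \o j); split => [a y z|y z|y|] /=; rewrite ?fq //.
- rewrite -f_lin; congr f; congr pair; rewrite /= ?mulr0 ?addr0//.
- by rewrite jM fM.
- exact: q_le.
Qed.

End Characters.

(** * The supremum of the modulus over the spectrum *)

Section CharacterTopology.
Context {R : realType} (A : topologicalAlgType R[i]).

Lemma ball_normc (e : R) (z w : R[i]^o) : ball z e%:C%C w -> normc (z - w) < e.
Proof. by rewrite -[ball _ _ _]/(is_true (`|z - w| < e%:C%C)) ltcR. Qed.

Lemma normc_ball (e : R) (z w : R[i]^o) : normc (z - w) < e -> ball z e%:C%C w.
Proof. by rewrite -[ball _ _ _]/(is_true (`|z - w| < e%:C%C)) ltcR. Qed.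

Lemma linear_sub (f : A -> R[i]^o) : linear f -> {morph f : x y / x - y}.
Proof. by move=> f_lin x y; rewrite addrC -scaleN1r f_lin scaleN1r addrC. Qed.

Lemma linear_scale (f : A -> R[i]^o) :
  linear f -> forall k x, f (k *: x) = k * f x.
Proof.
move=> f_lin k x; have f0 : f 0 = 0 by rewrite -(subrr 0) linear_sub// subrr.
by rewrite -[k *: x]addr0 f_lin f0 addr0.
Qed.

Context (P : set (A -> R)) (P_top : topology_determined_by P).

Lemma seminorm_ball_nbhs p x e : P p -> 0 < e -> nbhs x [set y | p (y - x) < e].
Proof.
move=> Pp e0; rewrite P_top; exists ([set p], e) => /=.
  by split=> // _ ->.
by move=> y; exact.
Qed.

(** A common zero of the defining seminorms lies in every neighbourhood of 0. *)
Lemma separating_seminorms x : (forall p, P p -> p x = 0) -> x = 0.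
Proof.
move=> Px0; apply/esym; apply: topalg_hausdorff => U V U0 Vx.
exists x; split; last exact: nbhs_singleton.
move: U0; rewrite P_top => -[[F e] [/= _ FP e0]]; apply => p Fp.
by rewrite subr0 Px0//; exact: FP.
Qed.

Lemma dominated_continuous p (f : A -> R[i]^o) : P p -> linear f ->
  (forall x, normc (f x) <= p x) -> continuous f.
Proof.
move=> Pp f_lin f_le x; apply/cvg_ballP => e e0.
have eE : e = (complex.Re e)%:C%C by rewrite RRe_real// gtr0_real.
have r0 : 0 < complex.Re e by move: e0; rewrite eE ltcR.
have x_ball := seminorm_ball_nbhs x Pp r0.
near=> y; rewrite eE; apply: normc_ball.
rewrite -normcN opprB -linear_sub//; apply: le_lt_trans (f_le _) _.
by near: y; exact: x_ball.
Unshelve. all: by end_near. Qed.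

Context (P_unif : P `<=` @uniform_seminorm R A).
Context (spec_equi : equicontinuous (spectrum A) id).

(** The value 0 is included so that the supremum is that of a nonempty set even
    if the spectrum is empty, which happens for the zero algebra. *)
Definition character_sup (x : A) : R :=
  sup [set r | r = 0 \/ exists2 f, spectrum A f & r = normc (f x)].

Lemma equicontinuous_uniform_bound : exists F e,
  [/\ finite_set F, F `<=` P, 0 < e & forall y, (forall p, F p -> p y < e) ->
    forall f, spectrum A f -> normc (f y) < 1].
Proof.
have := spec_equi 0 (entourage_ball (R[i]^o) 1%:pos).
rewrite /prop_near1 P_top => -[[F e] [/= Ffin FP e0] Fe].
exists F, e; split=> // y Fy f specf; have [f_lin _ _ _] := specf.
have f0 : f 0 = 0 by rewrite -(subrr 0) linear_sub// subrr.
have := Fe y; rewrite /= subr0 => /(_ Fy f specf) /= /(@ball_normc 1).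
by rewrite f0 sub0r normcN.
Qed.

(** The neighbourhood of 0 on which all characters are bounded by 1 absorbs [y]. *)
Lemma characters_bounded y :
  exists M, forall f, spectrum A f -> normc (f y) <= M.
Proof.
have [F [e [Ffin FP e0 Fe]]] := equicontinuous_uniform_bound.
have [M [M0 M_ge]] : exists M : R, 0 < M /\ forall p, F p -> p y <= M.
  have /finite_seqP[s sE] : finite_set [set p y | p in F] by exact:
    finite_image.
  exists (1 + \sum_(r <- s) `|r|); split.
    by rewrite ltr_wpDr// sumr_ge0.
  move=> p Fp; have : p y \in s.
    by have : [set` s] (p y) by rewrite -sE; exists p.
  move=> ys; rewrite (big_rem _ ys) /= addrCA ler_wpDr// ?ler_norm//.
  by rewrite addr_ge0// sumr_ge0.
pose t := e / (2 * M); have t0 : 0 < t by rewrite divr_gt0// mulr_gt0.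
exists t^-1 => f specf; have [f_lin _ _ _] := specf.
rewrite -[t^-1]mul1r ler_pdivlMr// mulrC -[t in t * _]gtr0_norm// -normc_real.
rewrite -ComplexField.Normc.normcM -linear_scale//; apply/ltW/Fe => // p Fp.
have [[_ _ pZ] _] := P_unif (FP _ Fp).
rewrite pZ normc_real gtr0_norm// (@le_lt_trans _ _ (t * M))//.
  by rewrite ler_wpM2l ?M_ge// ltW.
by rewrite /t invfM mulrA divfK ?gt_eqF// ltr_pdivrMr// ltr_pMr// ltr1n.
Qed.

Lemma character_sup_le y t : 0 <= t ->
  (forall f, spectrum A f -> normc (f y) <= t) ->
  character_sup y <= t.
Proof.
move=> t0 ft; apply: ge_sup; first by exists 0; left.
by move=> r [->//|[f specf ->]]; exact: ft.
Qed.

Lemma character_sup_has_ub y :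
  has_ubound [set r | r = 0 \/ exists2 f, spectrum A f & r = normc (f y)].
Proof.
have [M M_ge] := characters_bounded y; exists (Num.max 0 M) => r.
by move=> [->|[f specf ->]]; rewrite le_max ?lexx// M_ge// orbT.
Qed.

Lemma character_sup_ge y f : spectrum A f -> normc (f y) <= character_sup y.
Proof.
by move=> specf; apply: ub_le_sup (character_sup_has_ub y) _ _; right; exists f.
Qed.

Lemma character_sup_ge0 y : 0 <= character_sup y.
Proof. by apply: ub_le_sup (character_sup_has_ub y) _ _; left. Qed.

(** The norming character of [p] at [x] belongs to the spectrum. *)
Lemma le_character_sup p x : P p -> p x <= character_sup x.
Proof.
move=> Pp; have p_unif := P_unif Pp; have [[p_ge0 _ _] _] := p_unif.
have [px_le0|px_gt0] := leP (p x) 0.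
  exact: le_trans (character_sup_ge0 x).
have [f [f_lin fM f_le fx]] := exists_norming_character p_unif px_gt0.
rewrite -fx; apply: character_sup_ge; split => //.
- exact: dominated_continuous f_le.
- exists x; apply: contraTneq px_gt0 => fx0.
  by rewrite -fx fx0 ComplexField.Normc.normc0 ltxx.
Qed.

Lemma character_sup_seminorm : seminorm character_sup.
Proof.
split=> [x|x y|k x]; first exact: character_sup_ge0.
  apply: character_sup_le => [|f specf];
    first by rewrite addr_ge0// character_sup_ge0.
  have [f_lin _ _ _] := specf.
  have -> : f (x + y) = f x + f y by rewrite -[x]scale1r f_lin !scale1r.
  by rewrite (le_trans (le_normcD _ _))// lerD// character_sup_ge.
have kx_le l y : character_sup (l *: y) <= normc l * character_sup y.
  apply: character_sup_le => [|f specf];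
    first by rewrite mulr_ge0// ?normc_ge0 ?character_sup_ge0.
  have [f_lin _ _ _] := specf.
  by rewrite linear_scale// ComplexField.Normc.normcM ler_wpM2l ?normc_ge0//
    character_sup_ge.
have [->|k0] := eqVneq k 0.
  apply/eqP; rewrite eq_le kx_le ComplexField.Normc.normc0 mul0r.
  exact: character_sup_ge0.
apply/eqP; rewrite eq_le kx_le/=.
have nk0 : 0 < normc k.
  rewrite lt0r normc_ge0 andbT; apply: contra_neq k0;
    exact: ComplexField.Normc.eq0_normc.
rewrite mulrC -ler_pdivlMr// mulrC -ComplexField.Normc.normcV.
by have := kx_le k^-1 (k *: x); rewrite scalerA mulVf// scale1r.
Qed.

Lemma character_sup_submultiplicative : submultiplicative character_sup.
Proof.
move=> x y; apply: character_sup_le => [|f specf].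
  by rewrite mulr_ge0 ?character_sup_ge0.
have [_ fM _ _] := specf.
by rewrite fM ComplexField.Normc.normcM ler_pM ?normc_ge0 ?character_sup_ge.
Qed.

Lemma character_sup_square : square_preserving character_sup.
Proof.
move=> x; apply/eqP; rewrite eq_le expr2 character_sup_submultiplicative /=.
rewrite -expr2 -[leRHS]sqr_sqrtr ?character_sup_ge0//.
rewrite lerXn2r ?nnegrE ?character_sup_ge0 ?sqrtr_ge0//.
apply: character_sup_le => [|f specf]; first exact: sqrtr_ge0.
rewrite -(@ler_pXn2r _ 2) ?nnegrE ?sqrtr_ge0 ?normc_ge0// sqr_sqrtr
  ?character_sup_ge0//.
have [_ fM _ _] := specf.
by rewrite expr2 -ComplexField.Normc.normcM -fM character_sup_ge.
Qed.

Lemma character_sup_topology : topology_determined_by [set character_sup].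
Proof.
have [_ _ supZ] := character_sup_seminorm.
move=> x; apply/seteqP; split=> [U|U].
  rewrite P_top => -[[F e] [/= Ffin FP e0] FU].
  exists ([set character_sup], e) => /=; first by split=> //;
    exact: finite_set1.
  move=> y /= ye; apply: FU => p Fp /=.
  by apply: le_lt_trans (le_character_sup _ (FP _ Fp)) _; exact: ye.
move=> [[F e] [/= _ FP e0] FU]; rewrite P_top.
have [G [d [Gfin GP d0 Gd]]] := equicontinuous_uniform_bound.
exists (G, d * (e / 2)) => /=; first by split=> //; rewrite mulr_gt0// divr_gt0.
move=> y /= yG; apply: FU => q /= Fq; have -> : q = character_sup by exact: FP.
have e20 : 0 < e / 2 by rewrite divr_gt0.
have yE : y - x = (e / 2)%:C%C *: ((e / 2)^-1%:C%C *: (y - x)).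
  by rewrite scalerA -rmorphM divff ?gt_eqF// scale1r.
apply: (@le_lt_trans _ _ (e / 2));
  last by rewrite ltr_pdivrMr// ltr_pMr// ltr1n.
rewrite yE supZ normc_real gtr0_norm// ler_piMr ?(ltW e20)//.
apply: character_sup_le => // f specf; apply/ltW/Gd => // p Gp.
have [[_ _ pZ] _] := P_unif (GP _ Gp).
rewrite pZ normc_real gtr0_norm ?invr_gt0// mulrC ltr_pdivrMr//.
exact: yG.
Qed.

End CharacterTopology.

Theorem theorem2p4 (R : realType) (A : topologicalAlgType R[i]) :
  uniform_topological_algebra A ->
  equicontinuous (spectrum A) id ->
  uniform_normed_algebra A.
Proof.
move=> [P P_unif P_top] spec_equi; exists (@character_sup R A); split.
- split=> [|x x0]; first exact: character_sup_seminorm P_top P_unif spec_equi.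
  apply: (separating_seminorms P_top) => p Pp.
  have [[p_ge0 _ _] _] := P_unif _ Pp.
  apply/eqP; rewrite eq_le p_ge0 andbT -x0.
  exact: le_character_sup P_top P_unif spec_equi _ _ Pp.
- exact: character_sup_submultiplicative P_top P_unif spec_equi.
- exact: character_sup_square P_top P_unif spec_equi.
- exact: character_sup_topology P_top P_unif spec_equi.
Qed.
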